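(* Let $n\ge 1$, $N=2n$, and let $T$ be a rotationally symmetric standard Young tableau of shape $2\times n$. Then the $2$-web of the folded tableau $F(T)$ equals the web obtained by folding the $2$-web of $T$ to the right with respect to its axis of symmetry, i.e. $\mathcal{W}_{F(T)} = F(\mathcal{W}_T)$.
   Context: For a partition $\lambda$ with $N$ boxes, $\mathrm{SYT}(\lambda)$ is the set of standard Young tableaux of shape $\lambda$ with entries $1,\dots,N$. For a tableau $T$ and integer $k$, $T_{\le k}$ is the subtableau of entries $\le k$. Promotion $P:\mathrm{SYT}(\lambda)\to\mathrm{SYT}(\lambda)$: delete the entry $1$, leaving an empty box; repeatedly slide into the empty box the smaller of the entries immediately to its right and immediately below it (whichever exist) until neither exists; subtract $1$ from all entries; put $N$ in the empty box. For $k=1,\dots,N$, $P_k(T)$ is obtained by applying promotion to $T_{\le k}$ (a standard tableau of straight shape with entries $1,\dots,k$) and leaving entries $>k$ unchanged. Evacuation is $E=P_1\circ P_2\circ\cdots\circ P_N$; $T$ is self-evacuating if $E(T)=T$. For a rectangular shape, $T$ is called rotationally symmetric if it is self-evacuating, equivalently if any two entries in boxes that are opposite under $180^\circ$ rotation sum to $N+1$. For $j=1,\dots,\lfloor N/2\rfloor$ let $f^j=P_{N-2j+2}\circ P_{N-2j+4}\circ\cdots\circ P_N$, and define folding $F=f^{\lfloor N/2\rfloor}$. A $2$-web on $N=2n$ vertices is a perfect matching of $\{1,\dots,N\}$ drawn as non-crossing undirected arcs above a horizontal line with vertices $1,\dots,N$ from left to right. For $T\in\mathrm{SYT}(n,n)$,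 $\mathcal{W}_T$ is the unique $2$-web in which the entries of the first row of $T$ are exactly the left endpoints of arcs and the entries of the second row are exactly the right endpoints. A $2$-web is symmetric if it is invariant under $k\mapsto N+1-k$. Write $\bar{k}=N+1-k$. For a symmetric $2$-web $\mathcal{W}$, $F(\mathcal{W})$ is the $2$-web with the following arcs: whenever $\{a,b\}$ and $\{\bar a,\bar b\}$ are arcs of $\mathcal{W}$ with $a<b\le n$, $F(\mathcal{W})$ has arcs $\{N+1-2a,\ N+2-2b\}$ and $\{N+2-2a,\ N+1-2b\}$; whenever $\{a,\bar a\}$ is an arc of $\mathcal{W}$ with $a\le n$, $F(\mathcal{W})$ has the arc $\{N+1-2a,\ N+2-2a\}$. *)

(* Defs.v *)
From mathcomp Require Import all_boot.

Set Implicit Arguments.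
Unset Strict Implicit.
Unset Printing Implicit Defensive.

(* A tableau is the sequence of its rows, top row first; boxes are indexed by *)
(* (row, column), both from 0, while entries are 1, ..., N as usual.          *)
Definition tableau := seq (seq nat).

Implicit Types (T : tableau) (i j k : nat).

Definition has_box T i j : bool := j < size (nth [::] T i).

Definition entry T i j : nat := nth 0 (nth [::] T i) j.

Definition set_entry T i j (v : nat) : tableau :=
  set_nth [::] T i (set_nth 0 (nth [::] T i) j v).

Definition nboxes T : nat := sumn (shape T).

Definition is_partition (la : seq nat) : bool :=
  sorted geq la && (0 \notin la).

Definition is_SYT (la : seq nat) T : Prop :=
  [/\ is_partition la,
      shape T = la,
      perm_eq (flatten T) (iota 1 (sumn la)),
      forall i j, has_box T i j.+1 -> entry T i j < entry T i j.+1
    & forall i j, has_box T i.+1 j -> entry T i j < entry T i.+1 j].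

(* Rows that become empty are kept, so row i of T_{<= k} is a prefix of row i *)
(* of T for every i.                                                          *)
Definition restrict k T : tableau := [seq [seq x <- r | x <= k] | r <- T].

(* Slides the empty box (i, j) of T until it has no box to its right nor      *)
(* below it, and returns the final tableau with the final position of the     *)
(* empty box. The number stored at the empty box is meaningless and is never  *)
(* read. The first argument bounds the number of slides; nboxes T always      *)
(* suffices.                                                                  *)
Fixpoint slide (fuel : nat) T i j : tableau * (nat * nat) :=
  if fuel isn't m.+1 then (T, (i, j)) else
  let right := has_box T i j.+1 in
  let below := has_box T i.+1 j in
  if right && (below ==> (entry T i j.+1 < entry T i.+1 j)) then
    slide m (set_entry T i j (entry T i j.+1)) i j.+1
  else if below then
    slide m (set_entry T i j (entry T i.+1 j)) i.+1 j
  else (T, (i, j)).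

(* In a standard tableau the entry 1, deleted first, is in the box (0, 0).    *)
Definition promotion T : tableau :=
  let: (T', (i, j)) := slide (nboxes T) T 0 0 in
  set_entry [seq [seq x.-1 | x <- r] | r <- T'] i j (nboxes T).

(* P_k, for 1 <= k <= N: the entries > k of a row stay in place, to the right *)
(* of those of T_{<= k}.                                                      *)
Definition promotion_le k T : tableau :=
  [seq nth [::] (promotion (restrict k T)) i ++ [seq x <- nth [::] T i | k < x]
     | i <- iota 0 (size T)].

(* P_{k_1} \o P_{k_2} \o ... \o P_{k_m}: the last one is applied first.       *)
Definition promotions (ks : seq nat) T : tableau := foldr promotion_le T ks.

Definition evacuation T : tableau := promotions (iota 1 (nboxes T)) T.

Definition self_evacuating T : Prop := evacuation T = T.

Definition rotationally_symmetric T : Prop := self_evacuating T.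

(* f^j, with indices N - 2j + 2, N - 2j + 4, ..., N, for 2j <= N.             *)
Definition partial_folding j T : tableau :=
  promotions [seq nboxes T - 2 * j + 2 * i | i <- iota 1 j] T.

Definition folding T : tableau := partial_folding (nboxes T)./2 T.

(* The vertices 1, ..., N of a web are the nonzero elements of 'I_N.+1; a web *)
(* is the set of its arcs, an arc being the set of its two endpoints.         *)
Definition arcs (N : nat) := {set {set 'I_N.+1}}.

Definition perfect_matching N (W : arcs N) : bool :=
  partition W [set v : 'I_N.+1 | 0 < v] && [forall A in W, #|A| == 2].

Definition noncrossing N (W : arcs N) : bool :=
  [forall a : 'I_N.+1, forall b : 'I_N.+1, forall c : 'I_N.+1, forall d : 'I_N.+1,
     [&& a < b, b < c & c < d] ==>
     ~~ (([set a; c] \in W) && ([set b; d] \in W))].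

Definition is_web N (W : arcs N) : bool := perfect_matching W && noncrossing W.

Definition left_endpoints N (W : arcs N) : {set 'I_N.+1} :=
  [set a : 'I_N.+1 | [exists b : 'I_N.+1, (a < b) && ([set a; b] \in W)]].

Definition right_endpoints N (W : arcs N) : {set 'I_N.+1} :=
  [set b : 'I_N.+1 | [exists a : 'I_N.+1, (a < b) && ([set a; b] \in W)]].

Definition is_web_of n T (W : arcs (2 * n)) : bool :=
  [&& is_web W,
      left_endpoints W == [set v : 'I_(2 * n).+1 | val v \in nth [::] T 0]
    & right_endpoints W == [set v : 'I_(2 * n).+1 | val v \in nth [::] T 1]].

(* There is exactly one such web when T is standard of shape (n, n); the      *)
(* default value set0 is then not used.                                       *)
Definition web_of n T : arcs (2 * n) := odflt set0 [pick W | is_web_of T W].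

Definition arc N (x y : nat) : {set 'I_N.+1} := [set inord x; inord y].

(* The arcs of F(W) for a symmetric web W, with N = 2n; the reflection of a   *)
(* vertex x is N + 1 - x.                                                     *)
Definition fold_web n (W : arcs (2 * n)) : arcs (2 * n) :=
  let N := 2 * n in
  let bar x := N + 1 - x in
  [set A : {set 'I_N.+1} |
     [exists a : 'I_N.+1, exists b : 'I_N.+1,
        [&& a < b, b <= n, arc N a b \in W, arc N (bar a) (bar b) \in W
          & (A == arc N (N + 1 - 2 * a) (N + 2 - 2 * b))
            || (A == arc N (N + 2 - 2 * a) (N + 1 - 2 * b))]]
     || [exists a : 'I_N.+1,
           [&& a <= n, arc N a (bar a) \in W
             & A == arc N (N + 1 - 2 * a) (N + 2 - 2 * a)]]].

(* Main.v *)
Require Import Defs.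
From mathcomp Require Import all_boot.
From mathcomp Require Import zify.

(* Encode a two-row tableau by the word whose k-th letter tells whether k lies
   in the first row. Promotion deletes the first letter, turns the partner of
   that letter (if any) into an up-step, and appends a letter that is down iff
   there was a partner. Hence the part of the tableau still to be promoted
   after some steps of evacuation or folding is a factor of the initial word
   in which all unmatched down-steps are replaced by up-steps.
   Evacuation therefore reverses and complements the word, and the j-th step
   of folding appends two letters that record whether the letters j and
   N + 1 - j have partners in the factors [j, N + 1 - j] and
   [j + 1, N + 1 - j]. For a symmetric web these letters are the endpoints of
   the arcs of the folded web, and a non-crossing matching is determined by
   its left endpoints. *)

Set Implicit Arguments.
Unset Strict Implicit.
Unset Printing Implicit Defensive.

(** * Promotion on words *)

Fixpoint positions (b : bool) (i : nat) (w : seq bool) : seq nat :=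
  if w is x :: w' then
    if x == b then i :: positions b i.+1 w' else positions b i.+1 w'
  else [::].

Definition tab (w : seq bool) : tableau :=
  [:: positions true 1 w; positions false 1 w].

Fixpoint run (h : nat) (s : seq bool) : option nat :=
  match s with
  | [::] => Some h
  | true :: s' => run h.+1 s'
  | false :: s' => if h is h'.+1 then run h' s' else None
  end.

Fixpoint falls (h : nat) (s : seq bool) : bool :=
  match s with
  | [::] => false
  | true :: s' => falls h.+1 s'
  | false :: s' => if h is h'.+1 then falls h' s' else true
  end.

(** For [h = 0] the raised step is the partner of an up-step deleted in front of [s]; its entry is
    the one that moves from the second row to the first during the slides. *)
Fixpoint lift1 (h : nat) (s : seq bool) : seq bool :=
  match s with
  | [::] => [::]
  | true :: s' => true :: lift1 h.+1 s'
  | false :: s' => if h is h'.+1 then false :: lift1 h' s' else true :: s'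
  end.

(* Replaces by up-steps all the down-steps matched neither in [s] nor by the
   [h] up-steps preceding it. *)
Fixpoint rectify (h : nat) (s : seq bool) : seq bool :=
  match s with
  | [::] => [::]
  | true :: s' => true :: rectify h.+1 s'
  | false :: s' =>
      if h is h'.+1 then false :: rectify h' s' else true :: rectify 0 s'
  end.

Definition promw (w : seq bool) : seq bool :=
  rcons (lift1 0 (behead w)) (~~ falls 0 (behead w)).

Lemma mem_positions b i w v :
  (v \in positions b i w) = [&& i <= v, v < i + size w & nth (~~ b) w (v - i) == b].
Proof.
elim: w i => [|x w IHw] i /=; first by rewrite in_nil; lia.
have -> : (v \in if x == b then i :: positions b i.+1 w else positions b i.+1 w)
  = ((v == i) && (x == b)) || (v \in positions b i.+1 w).
  by case: (x == b); rewrite ?inE ?andbT ?andbF.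
rewrite IHw addSnnS; case: (ltngtP i v) => [lt_iv|lt_vi|->] //=.
- by rewrite (_ : v - i = (v - i.+1).+1) //; lia.
- by rewrite subnn addnS ltnS leq_addr /= orbF.
Qed.

Lemma size_positions b i w : size (positions b i w) = count (fun x : bool => x == b) w.
Proof. by elim: w i => //= x w IHw i; case: eqP => _ /=; rewrite IHw. Qed.

Lemma positions_cat b i v w :
  positions b i (v ++ w) = positions b i v ++ positions b (i + size v) w.
Proof.
elim: v i => [|x v IHv] i /=; first by rewrite addn0.
by rewrite IHv addSnnS; case: eqP.
Qed.

Lemma positions_pred b i w : map predn (positions b i.+1 w) = positions b i w.
Proof. by elim: w i => //= x w IHw i; case: eqP => _ /=; rewrite IHw. Qed.

Lemma positions_map b (f : nat -> bool) i m :
  positions b i (map f (iota i m)) = [seq x <- iota i m | f x == b].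
Proof. by elim: m i => //= m IHm i; rewrite IHm. Qed.

Lemma positions_le b i k w :
  [seq x <- positions b i w | x < i + k] = positions b i (take k w).
Proof.
elim: w i k => [|x w IHw] i [|k] //=.
- rewrite addn0; case: eqP => _ /=; rewrite ?ltnn;
  by apply/eqP; rewrite -(negbK (_ == _)) -has_filter; apply/hasPn => y;
    rewrite mem_positions; lia.
- by case: eqP => _ /=; rewrite -addSnnS IHw ?leq_addr // addSn ltnS leq_addr.
Qed.

Lemma positions_gt b i k w :
  [seq x <- positions b i w | i + k <= x] = positions b (i + k) (drop k w).
Proof.
elim: w i k => [|x w IHw] i [|k] //=.
- rewrite addn0; case: eqP => _ /=; rewrite ?leqnn;
  by rewrite (all_filterP _) //; apply/allP => y; rewrite mem_positions; lia.
- case: eqP => _ /=; rewrite -addSnnS IHw //.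
  by rewrite addSn ltnNge leq_addr.
Qed.

Lemma tab_inj v w : size v = size w -> tab v = tab w -> v = w.
Proof.
move=> eq_sz [eq_pos _]; apply: (@eq_from_nth _ false) => // i lt_i.
have : (i.+1 \in positions true 1 v) = (i.+1 \in positions true 1 w).
  by rewrite eq_pos.
rewrite !mem_positions !add1n !ltnS -eq_sz lt_i /= subn1 /=.
by do 2!case: nth.
Qed.

Lemma nboxes_tab w : nboxes (tab w) = size w.
Proof.
rewrite /nboxes /= !size_positions addn0 -(count_predC id w); congr (_ + _);
  by apply: eq_count => -[].
Qed.

Lemma restrict_tab k w : restrict k (tab w) = tab (take k w).
Proof. by rewrite /restrict /tab -!positions_le. Qed.

Lemma set_nth_cat (p q : seq nat) x y :
  set_nth 0 (p ++ x :: q) (size p) y = p ++ y :: q.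
Proof. by elim: p => //= z p ->. Qed.

Lemma nth_size_cat (p q : seq nat) x : nth 0 (p ++ x :: q) (size p) = x.
Proof. by rewrite nth_cat ltnn subnn. Qed.

Lemma nth_size_catS (p q : seq nat) x y :
  nth 0 (p ++ x :: y :: q) (size p).+1 = y.
Proof. by rewrite -cat_rcons -(size_rcons p x) nth_size_cat. Qed.

Lemma slide_bottom m (r p q : seq nat) x : size q <= m ->
  slide m [:: r; p ++ x :: q] 1 (size p)
    = ([:: r; rcons (p ++ q) (last x q)], (1, size (p ++ q))).
Proof.
elim: m p x q => [|m IHm] p x [|y q] //= le_qm; rewrite ?cats0 ?cats1 //.
- by rewrite /has_box /= size_rcons ltnn.
rewrite /has_box /= [in _ < _]size_cat /= !addnS !ltnS leq_addr /=.
rewrite /set_entry /entry /= set_nth_cat nth_size_catS.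
by have := IHm (rcons p y) y q le_qm; rewrite size_rcons !cat_rcons.
Qed.

(** Induction on the letters not yet read. The hole follows [p] in the first row, [p1] is the
    settled part of the second row, and [h] is the number of columns by which the hole is ahead of
    [p1]. An up-step moves its entry left into the hole; a down-step is merely recorded as long as
    [h > 0]. The values [x] and [z] in the hole are stale. *)
Lemma slide_top m h i (p p1 : seq nat) x s :
  size s <= m -> size p = size p1 + h ->
  exists z, slide m [:: p ++ x :: positions true i s; p1 ++ positions false i s]
              0 (size p)
    = if falls h s then
        ([:: p ++ positions true i (lift1 h s);
             rcons (p1 ++ positions false i (lift1 h s)) z],
         (1, size (p1 ++ positions false i (lift1 h s))))
      else
        ([:: rcons (p ++ positions true i (lift1 h s)) z;
             p1 ++ positions false i (lift1 h s)],
         (0, size (p ++ positions true i (lift1 h s)))).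
Proof.
elim: s m h i p p1 x => [|[] s IHs] m h i p p1 x /=.
- move=> _ eq_sz; exists x; rewrite !cats0 cats1.
  case: m => //= m; rewrite /has_box /= size_rcons ltnn /=.
  by rewrite eq_sz ltnNge leq_addr.
- case: m => //= m le_sm eq_sz; rewrite ltnS in le_sm.
  have [|z Hz] := IHs m h.+1 i.+1 (rcons p i) p1 i le_sm.
    by rewrite size_rcons eq_sz addnS.
  exists z; rewrite /has_box /= [size (p ++ _)]size_cat /= !addnS !ltnS leq_addr.
  rewrite /set_entry /entry /= set_nth_cat nth_size_catS.
  (* An entry below the hole, if there is one, comes from the unread letters and so exceeds [i]. *)
  have -> : (size p < size (p1 ++ positions false i.+1 s)) ==>
      (i < nth 0 (p1 ++ positions false i.+1 s) (size p)).
    apply/implyP; rewrite size_cat nth_cat => lt_p.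
    have -> : size p < size p1 = false by lia.
    rewrite eq_sz addKn.
    have /(mem_nth 0) : h < size (positions false i.+1 s) by lia.
    by rewrite mem_positions => /andP[].
  rewrite size_rcons in Hz *; rewrite -cat_rcons Hz.
  by rewrite !cat_rcons.
- case: h => [|h].
  + case: m => //= m le_sm eq_sz; rewrite ltnS in le_sm.
    have {}eq_sz : size p = size p1 by rewrite eq_sz addn0.
    rewrite /has_box /entry /set_entry /= eq_sz nth_size_cat.
    rewrite [size (p1 ++ _)]size_cat /= addnS ltnS leq_addr /=.
    (* Here [i] lies directly below the hole and is smaller than any entry to the right of the hole,
       so the hole drops to the second row and stays there. *)
    have -> : ((size p1).+1 < size (p ++ x :: positions true i.+1 s)) &&
      (nth 0 (p ++ x :: positions true i.+1 s) (size p1).+1 < i) = false.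
      have : forall y, y \in positions true i.+1 s -> i < y.
        by move=> y; rewrite mem_positions => /andP[].
      case: (positions true i.+1 s) => [_|y q gt_i].
        by rewrite size_cat /= addn1 -eq_sz ltnn.
      have /ltnW := gt_i y (mem_head y q).
      by rewrite -eq_sz nth_size_catS leqNgt => /negbTE ->; rewrite andbF.
    exists (last i (positions false i.+1 s)).
    rewrite -eq_sz set_nth_cat eq_sz slide_bottom // size_positions.
    by apply: leq_trans le_sm; apply: count_size.
  + move=> le_sm eq_sz.
    have [|z Hz] := IHs m h i.+1 p (rcons p1 i) x (ltnW le_sm).
      by rewrite size_rcons eq_sz addnS.
    by exists z; move: Hz; rewrite !cat_rcons => ->.
Qed.

Lemma size_lift1 h s : size (lift1 h s) = size s.
Proof. by elim: s h => [|[] s IHs] [|h] //=; rewrite IHs. Qed.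

Lemma size_promw x s : size (promw (x :: s)) = size (x :: s).
Proof. by rewrite size_rcons size_lift1. Qed.

Lemma promotion_tab s : promotion (tab (true :: s)) = tab (promw (true :: s)).
Proof.
rewrite /promotion nboxes_tab /tab /promw /=.
have [z /= ->] := @slide_top (size s).+1 0 2 [::] [::] 1 s (leqnSn _) erefl.
(* The final write hits the stale entry, so [z] disappears. *)
have set_last b v y : set_nth 0 (map predn (rcons (positions b 2 v) z))
    (size (positions b 2 v)) y = rcons (positions b 1 v) y.
  rewrite map_rcons positions_pred size_positions -(size_positions b 1) -!cats1.
  by rewrite set_nth_cat.
rewrite -[rcons (lift1 0 s) _]cats1 !positions_cat /= size_lift1 add1n.
by case: (falls 0 s);
  rewrite /set_entry /= set_last positions_pred cats0 cats1.
Qed.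

Lemma promotion_le_tab k w s : take k w = true :: s ->
  promotion_le k (tab w) = tab (promw (true :: s) ++ drop k w).
Proof.
move=> eq_w; have le_k : size (promw (true :: s)) = minn k (size w).
  by rewrite size_promw -eq_w size_take_min.
rewrite /promotion_le restrict_tab eq_w promotion_tab /tab [LHS]/=.
have filterE b : [seq x <- positions b 1 w | k < x]
    = positions b (1 + size (promw (true :: s))) (drop k w).
  rewrite [LHS](positions_gt b 1 k w) le_k.
  by have [//|le_wk] := leqP k (size w); rewrite drop_oversize // ltnW.
by rewrite !filterE -!positions_cat.
Qed.

(** * Evacuation and folding on words *)

Lemma size_rectify h s : size (rectify h s) = size s.
Proof. by elim: s h => [|[] s IHs] [|h] //=; rewrite IHs. Qed.

(** The witness is the number of up-steps still open after [s]. Its value is left out because only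
    the splitting matters. *)
Lemma rectify_cat h s : exists h', forall t,
  rectify h (s ++ t) = rectify h s ++ rectify h' t.
Proof.
elim: s h => [|[] s IHs] h /=; first by exists h.
- by have [h' Hh'] := IHs h.+1; exists h' => t; rewrite Hh'.
- case: h => [|h]; first by have [h' Hh'] := IHs 0; exists h' => t; rewrite Hh'.
  by have [h' Hh'] := IHs h; exists h' => t; rewrite Hh'.
Qed.

Lemma run_rectify_cat h s h' t : run h s = Some h' ->
  rectify h (s ++ t) = s ++ rectify h' t.
Proof.
elim: s h => [|[] s IHs] h /=; first by case=> ->.
- by move/IHs => ->.
- by case: h => // h /IHs ->.
Qed.

Lemma run_rectify h s h' : run h s = Some h' -> rectify h s = s.
Proof. by move/(run_rectify_cat [::]); rewrite !cats0. Qed.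

Lemma falls_cat h s t : falls h s -> falls h (s ++ t).
Proof. by elim: s h => [|[] s IHs] [|h] //=; apply: IHs. Qed.

(** The path drops by [h - h'] in total, more than a start at height [k] permits. *)
Lemma run_falls h s h' k : run h s = Some h' -> h' + k < h -> falls k s.
Proof.
elim: s h k => [|[] s IHs] h k /=.
- by case=> <-; rewrite ltnNge leq_addr.
- by move=> run_s lt_h; apply: IHs run_s _; rewrite addnS ltnS.
- case: h => // h run_s; case: k => //= k.
  by rewrite addnS ltnS; apply: IHs run_s.
Qed.

Lemma falls_rectify_le h k s : k <= h -> falls h (rectify k s) = false.
Proof.
elim: s h k => [|[] s IHs] h k //= le_kh; first exact: IHs.
case: k le_kh => [|k] le_kh /=; first exact: IHs.
by case: h le_kh => //= h le_kh; apply: IHs.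
Qed.

Lemma lift1_id h s : falls h s = false -> lift1 h s = s.
Proof.
elim: s h => [|[] s IHs] h //=; first by move/IHs ->.
by case: h => // h /IHs ->.
Qed.

Lemma falls_rectifyS h s : falls h (rectify h.+1 s) = falls h s.
Proof. by elim: s h => [|[] s IHs] [|h] //=. Qed.

(** One more up-step in front spares at most one further down-step, its partner, and this is the
    first fall from height [h]. *)
Lemma lift1_rectifyS h s : lift1 h (rectify h.+1 s) = rectify h s.
Proof. by elim: s h => [|[] s IHs] [|h] //=; rewrite IHs. Qed.

(* The appended letter is a down-step exactly when the deleted letter is an
   up-step that has a partner in [s]. *)
Lemma promw_rectify x s :
  promw (rectify 0 (x :: s)) = rcons (rectify 0 s) (~~ (x && falls 0 s)).
Proof.
rewrite /promw; case: x => /=; first by rewrite lift1_rectifyS falls_rectifyS.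
by rewrite lift1_id falls_rectify_le.
Qed.

Lemma promotion_le_rectify x s t :
  promotion_le (size s).+1 (tab (rectify 0 (x :: s) ++ t))
    = tab (rectify 0 s ++ ~~ (x && falls 0 s) :: t).
Proof.
have sz : size (rectify 0 (x :: s)) = (size s).+1 by rewrite size_rectify.
(* A rectified nonempty word begins with an up-step, as [promotion_le_tab] requires. *)
have /promotion_le_tab -> : take (size s).+1 (rectify 0 (x :: s) ++ t)
    = true :: behead (rectify 0 (x :: s)).
  by rewrite -sz take_size_cat //; case: (x).
have -> : true :: behead (rectify 0 (x :: s)) = rectify 0 (x :: s).
  by case: (x).
by rewrite promw_rectify -sz drop_size_cat // cat_rcons.
Qed.

Fixpoint evac_letters (s : seq bool) : seq bool :=
  if s is x :: s' then ~~ (x && falls 0 s') :: evac_letters s' else [::].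

Lemma iotaS_rcons m : iota 1 m.+1 = rcons (iota 1 m) m.+1.
Proof. by rewrite -{1}[m.+1]addn1 iotaD cats1 add1n. Qed.

Lemma promotions_iota s t :
  promotions (iota 1 (size s)) (tab (rectify 0 s ++ t))
    = tab (rev (evac_letters s) ++ t).
Proof.
elim: s t => [|x s IHs] t //.
(* The promotion with the largest index acts first, and later letters are placed to the left of
   earlier ones; hence the reversal. *)
rewrite [size _]/= iotaS_rcons /promotions foldr_rcons promotion_le_rectify.
by rewrite -/(promotions _ _) IHs rev_cons cat_rcons.
Qed.

(** In a path that ends at height 0 every up-step has a later partner. *)
Lemma evac_letters_run h s : run h s = Some 0 -> evac_letters s = map negb s.
Proof.
elim: s h => [|[] s IHs] h //= run_s.
- by rewrite (IHs _ run_s) (@run_falls h.+1 s 0).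
- by case: h run_s => // h run_s; rewrite (IHs _ run_s).
Qed.

Lemma evacuation_tab w : run 0 w = Some 0 ->
  evacuation (tab w) = tab (rev (map negb w)).
Proof.
move=> run_w; rewrite /evacuation nboxes_tab -{2}(cats0 w).
by rewrite -{2}(run_rectify run_w) promotions_iota (evac_letters_run run_w) cats0.
Qed.

(** The index of the next promotion is smaller by two, so each step freezes two letters: the last
    one of the remaining rectified word and the appended one. *)
Fixpoint fold_letters (m : nat) (s : seq bool) : seq bool :=
  if m is m'.+1 then
    fold_letters m' (take m'.*2 (behead s)) ++
      [:: last true (rectify 0 (behead s)); ~~ (head true s && falls 0 (behead s))]
  else [::].

Lemma size_fold_letters m s : size (fold_letters m s) = m.*2.
Proof. by elim: m s => //= m IHm s; rewrite size_cat IHm addn2. Qed.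

Lemma promotions_fold m s t : size s = m.*2 ->
  promotions [seq 2 * i | i <- iota 1 m] (tab (rectify 0 s ++ t))
    = tab (fold_letters m s ++ t).
Proof.
elim: m s t => [|m IHm] [|x s] t // [sz_s].
rewrite iotaS_rcons map_rcons.
rewrite /promotions foldr_rcons.
rewrite (_ : 2 * m.+1 = (size s).+1); last by rewrite sz_s -mul2n; lia.
rewrite promotion_le_rectify -/(promotions _ _) -catA /=.
have sz_take : size (take m.*2 s) = m.*2 by rewrite size_take sz_s leqnn.
rewrite -IHm //; congr (promotions _ (tab _)).
(* Rectification reads from the left, so it commutes with cutting off the last letter. *)
suff {1}-> : rectify 0 s = rcons (rectify 0 (take m.*2 s)) (last true (rectify 0 s)).
  by rewrite cat_rcons.
have [h' Hh'] := rectify_cat 0 (take m.*2 s).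
have := Hh' (drop m.*2 s); rewrite cat_take_drop => ->.
have : size (drop m.*2 s) = 1 by rewrite size_drop sz_s subSnn.
case: (drop m.*2 s) => [|y []] //= _.
by case: y; case: h' {Hh'} => [|h'] /=; rewrite last_cat /= cats1.
Qed.

Lemma folding_tab w : ~~ odd (size w) -> run 0 w = Some 0 ->
  folding (tab w) = tab (fold_letters (size w)./2 w).
Proof.
move=> even_w run_w; have sz : (size w)./2.*2 = size w by lia.
rewrite /folding /partial_folding nboxes_tab mul2n sz subnn.
rewrite -{2}(cats0 w) -{2}(run_rectify run_w) promotions_fold ?cats0 //.
Qed.

(** With vertices counted from 1, this factor starts right after vertex [i] and ends with vertex
    [j]. *)
Definition slice (w : seq bool) i j := drop i (take j w).

(** Each step strips one letter from both ends, so after [a] steps the indices [a] to [2m - a - 1]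
    remain, and the next two letters are frozen at the end of a word of length [2(m - a)]. *)
Lemma nth_fold_letters m s a : size s = m.*2 -> a < m ->
  (nth true (fold_letters m s) ((m - a.+1).*2) =
     last true (rectify 0 (slice s a.+1 (m.*2 - a)))) *
  (nth true (fold_letters m s) ((m - a.+1).*2.+1) =
     ~~ (nth true s a && falls 0 (slice s a.+1 (m.*2 - a)))).
Proof.
elim: m s a => [|m IHm] [|x s] [|a] //= [sz_s]; rewrite ?ltnS => lt_am.
  rewrite subSS !subn0 !nth_cat size_fold_letters ltnn ltnNge leqnSn /= subnn.
  by rewrite subSnn /slice /= drop0 -sz_s take_size.
rewrite subSS !nth_cat size_fold_letters.
have -> : (m - a.+1).*2 < m.*2 by lia.
have -> : (m - a.+1).*2.+1 < m.*2 by lia.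
have sz_take : size (take m.*2 s) = m.*2 by rewrite size_take sz_s leqnn.
rewrite !IHm // /slice doubleS subSS subSn /=; last by lia.
by rewrite nth_take ?take_takel ?leq_subr //; lia.
Qed.

Lemma run_count h s :
  (forall k, k <= size s ->
     count negb (take k s) <= h + count id (take k s)) ->
  run h s = Some (h + count id s - count negb s).
Proof.
elim: s h => [|x s IHs] h le_count /=; first by rewrite addn0 subn0.
have le_tail k : k <= size s -> x + h + count id (take k s)
    >= ~~ x + count negb (take k s).
  by move=> le_k; have /= := le_count k.+1 le_k; lia.
case: x le_tail {le_count} => /= le_tail.
  by rewrite IHs => [|k /le_tail]; [congr Some; lia | lia].
case: h le_tail => [|h] le_tail; first by have := le_tail 0 isT; rewrite take0.
by rewrite IHs => [|k /le_tail]; [congr Some; lia | lia].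
Qed.

(** * Standard two-row tableaux as ballot words *)

Lemma SYT_tab n T : is_SYT [:: n; n] T ->
  exists w, [/\ T = tab w, size w = 2 * n, count id w = n &
    forall k, k <= size w -> k <= 2 * count id (take k w)].
Proof.
case=> _ sh_T; case: T sh_T => [|r0 [|r1 []]] //= [sz0 sz1].
rewrite cats0 addn0 addnn -mul2n => perm_T row_lt col_lt.
have mem_T v : (v \in r0) || (v \in r1) = (0 < v <= 2 * n).
  by rewrite -mem_cat (perm_mem perm_T) mem_iota; lia.
have uniq_T : uniq (r0 ++ r1) by rewrite (perm_uniq perm_T) iota_uniq.
pose N := 2 * n.
pose w := [seq x \in r0 | x <- iota 1 N].
have sz_w : size w = N by rewrite size_map size_iota.
have sorted_row (r : seq nat) : (forall j, j.+1 < size r -> nth 0 r j < nth 0 r j.+1) ->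
    sorted ltn r.
  by move=> lt_r; apply/(sortedP 0) => j /lt_r.
have sorted0 : sorted ltn r0 by apply: sorted_row => j; apply: (row_lt 0).
have sorted1 : sorted ltn r1 by apply: sorted_row => j; apply: (row_lt 1).
have sorted_eq (r s : seq nat) : sorted ltn r -> sorted ltn s -> r =i s -> r = s.
  by apply: irr_sorted_eq; [apply: ltn_trans | apply: ltnn].
have sorted_iota b : sorted ltn [seq x <- iota 1 N | (x \in r0) == b].
  by apply: sorted_filter (iota_ltn_sorted _ _); apply: ltn_trans.
have row1_row0 v : v \in r1 -> v \notin r0.
  move: uniq_T; rewrite cat_uniq => /and3P[_ /hasPn + _]; exact.
(* Strictly increasing rows are determined by their sets of entries. *)
have T_w : [:: r0; r1] = tab w.
  rewrite /tab /w !positions_map; congr [:: _; _]; apply: sorted_eq => // v.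
    rewrite mem_filter mem_iota; have := mem_T v.
    by case: (v \in r0) => //= <-; lia.
  rewrite mem_filter mem_iota; have := mem_T v; have /implyP := row1_row0 v.
  by case: (v \in r0); case: (v \in r1) => //= _; lia.
exists w; split=> //.
  have -> : count id w = count (fun x : bool => x == true) w by apply: eq_count => -[].
  by rewrite -(size_positions _ 1); case: T_w => <-.
move=> k le_k.
have count_row b (r : seq nat) : r = positions b 1 w ->
    count (fun x => x <= k) r = count (fun x : bool => x == b) (take k w).
  by move=> ->; rewrite -(size_positions _ 1) -positions_le size_filter.
case: T_w => /count_row T_w0 /count_row T_w1.
(* By column strictness each entry [<= k] of the second row has one above it; this is the ballot
   inequality. *)
have : count (fun x => x <= k) r1 <= count (fun x => x <= k) r0.
  have {col_lt}: forall j, j < size r1 -> nth 0 r0 j < nth 0 r1 j.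
    by move=> j; apply: (col_lt 0).
  have : size r0 = size r1 by rewrite sz0 sz1.
  elim: (r0) (r1) => [|x s0 IHs] [|y s1] //= [sz_s] lt_s.
  have := IHs s1 sz_s (fun j => lt_s j.+1); have /= := lt_s 0 isT.
  by lia.
rewrite T_w0 T_w1.
have := count_predC id (take k w); rewrite size_takel //.
rewrite (@eq_count _ id (fun x : bool => x == true)); last by case.
rewrite (@eq_count _ (predC id) (fun x : bool => x == false)); last by case.
by lia.
Qed.

(** * Webs as relations *)

(** Webs over natural numbers, with the left endpoint first, so that case analyses on endpoints
    become linear arithmetic. *)
Definition arc_relation N (R : rel nat) : Prop :=
  [/\ forall a b, R a b -> [&& 0 < a, a < b & b <= N],
      forall v, 0 < v <= N -> (exists b, R v b) \/ (exists a, R a v),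
      forall a b c d, R a b -> R c d -> [|| a == c, a == d, b == c | b == d] ->
        a = c /\ b = d
    & forall a b c d, R a c -> R b d -> a < b -> b < c -> c < d -> False].

Definition arcs_of_rel N (R : rel nat) : arcs N :=
  [set A : {set 'I_N.+1} |
     [exists a : 'I_N.+1, exists b : 'I_N.+1, R a b && (A == [set a; b])]].

Lemma set2_inj (I : finType) (a b c d : I) : [set a; b] = [set c; d] ->
  (a = c /\ b = d) \/ (a = d /\ b = c).
Proof.
move/setP => eq_ab; move: (eq_ab a) (eq_ab b) (eq_ab c) (eq_ab d).
rewrite !inE !eqxx !orbT => /esym/orP[]/eqP-> /esym/orP[]/eqP->; auto.
- by move=> _ /orP[]/eqP ->; left.
- by move=> /orP[]/eqP ->; left.
Qed.

Lemma arcs_of_relP N (R : rel nat) A :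
  reflect (exists a b : 'I_N.+1, R a b /\ A = [set a; b]) (A \in arcs_of_rel N R).
Proof.
rewrite inE; apply: (iffP existsP) => [[a /existsP[b /andP[Rab /eqP->]]]|].
  by exists a, b.
by move=> [a [b [Rab ->]]]; exists a; apply/existsP; exists b; rewrite Rab eqxx.
Qed.

Lemma mem_arcs_of_rel N R (a b : 'I_N.+1) : arc_relation N R -> a <= b ->
  ([set a; b] \in arcs_of_rel N R) = R a b.
Proof.
move=> [R_dom _ _ _] le_ab; apply/arcs_of_relP/idP => [[c [d [Rcd]]]|Rab].
  by have := R_dom _ _ Rcd => lt_cd /set2_inj[[-> ->]|[eq_ad eq_bc]] //;
    move: le_ab; rewrite eq_ad eq_bc; lia.
by exists a, b.
Qed.

Lemma is_web_arcs_of_rel N R : arc_relation N R -> is_web (arcs_of_rel N R).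
Proof.
move=> RP; have [R_dom R_ex R_uniq R_nc] := RP.
apply/andP; split; last first.
  apply/'forall_'forall_'forall_'forall_implyP => a b c d /and3P[ab bc cd].
  apply/negP; rewrite !mem_arcs_of_rel ?(ltnW (ltn_trans _ _)) //; try lia.
  by case/andP=> Rac Rbd; apply: R_nc Rac Rbd _ _ _.
apply/andP; split; last first.
  apply/forall_inP => A /arcs_of_relP[a [b [/R_dom /and3P[_ ab _] ->]]].
  by rewrite cards2 -val_eqE neq_ltn ab.
apply/and3P; split.
- apply/eqP/setP => v; rewrite inE; apply/bigcupP/idP.
    move=> [A /arcs_of_relP[a [b [/R_dom ab ->]]]]; rewrite !inE.
    by case/orP => /eqP ->; lia.
  move=> v_gt0; have /R_ex : 0 < v <= N by rewrite v_gt0 leq_ord.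
  case=> [[b Rvb]|[a Rav]].
    have lt_b : b < N.+1 by have := R_dom _ _ Rvb; lia.
    exists [set v; Ordinal lt_b]; last by rewrite !inE eqxx.
    by apply/arcs_of_relP; exists v, (Ordinal lt_b).
  have lt_a : a < N.+1 by have := R_dom _ _ Rav; lia.
  exists [set Ordinal lt_a; v]; last by rewrite !inE eqxx orbT.
  by apply/arcs_of_relP; exists (Ordinal lt_a), v.
- apply/trivIsetP => A B /arcs_of_relP[a [b [Rab ->]]] /arcs_of_relP[c [d [Rcd ->]]].
  apply: contraR; rewrite -setI_eq0 => /set0Pn[v]; rewrite !inE => v_in.
  have [|/val_inj -> /val_inj ->] // := R_uniq _ _ _ _ Rab Rcd.
  by case/andP: v_in => /orP[] /eqP -> /orP[] /eqP ->; rewrite eqxx ?orbT.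
- apply/negP => /arcs_of_relP[a [b [_ /setP/(_ a)]]].
  by rewrite !inE eqxx.
Qed.

(** The bound [b <= N] keeps out the numbers that [inord] would collapse to 0. *)
Definition rel_of_arcs N (W : arcs N) : rel nat :=
  fun a b => (a < b <= N) && (Defs.arc N a b \in W).

Lemma rel_of_arcsE N (W : arcs N) (a b : 'I_N.+1) :
  rel_of_arcs W a b = (a < b) && ([set a; b] \in W).
Proof. by rewrite /rel_of_arcs /Defs.arc !inord_val leq_ord andbT. Qed.

Lemma set2_lt N (A : {set 'I_N.+1}) : #|A| = 2 ->
  exists a b : 'I_N.+1, a < b /\ A = [set a; b].
Proof.
move/eqP/cards2P => [a [b [neq_ab ->]]].
have [ab|ba|/val_inj eq_ab] := ltngtP a b.
- by exists a, b.
- by exists b, a; rewrite setUC.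
- by rewrite eq_ab eqxx in neq_ab.
Qed.

Lemma rel_of_arcs_rel N (W : arcs N) : is_web W -> arc_relation N (rel_of_arcs W).
Proof.
case/andP=> /andP[/and3P[/eqP cover_W /trivIsetP triv_W _] /forall_inP card_W] nc_W.
have ordE a : a <= N -> exists i : 'I_N.+1, a = i.
  by move=> le_aN; exists (Ordinal (n := N.+1) le_aN).
have rel_ord a b : rel_of_arcs W a b -> exists i j : 'I_N.+1,
    [/\ a = i, b = j, i < j & [set i; j] \in W].
  move=> Rab; case/andP: (Rab) => /andP[ab bN] _.
  have [i eq_a] := ordE a (leq_trans (ltnW ab) bN); have [j eq_b] := ordE b bN.
  by move: Rab; rewrite eq_a eq_b rel_of_arcsE => /andP[]; exists i, j.
split.
- move=> a b /rel_ord[i [j [-> -> ij Wij]]]; rewrite ij leq_ord andbT.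
  have : i \in cover W by apply/bigcupP; exists [set i; j]; rewrite // !inE eqxx.
  by rewrite cover_W inE => ->.
- move=> v /andP[v_gt0 /ordE[i eq_v]]; rewrite {}eq_v in v_gt0 *.
  have : i \in cover W by rewrite cover_W inE.
  case/bigcupP => A WA; have [a [b [ab eq_A]]] := set2_lt (eqP (card_W A WA)).
  rewrite eq_A in WA *; rewrite !inE => /orP[]/eqP->; [left; exists b|right; exists a];
    by rewrite rel_of_arcsE ab.
- move=> _ _ _ _ /rel_ord[a [b [-> -> ab Wab]]] /rel_ord[c [d [-> -> cd Wcd]]] meet.
  have /eqP/set2_inj[[-> ->]|[eq_ad eq_bc]] // : [set a; b] == [set c; d].
    apply: contraLR meet => /(triv_W _ _ Wab Wcd).
    rewrite -setI_eq0 => /eqP/setP disj.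
    have := disj a; have := disj b; rewrite !inE !eqxx ?orbT /= -!val_eqE /=.
    by rewrite orbA => -> ->.
  by move: ab cd; rewrite eq_ad eq_bc; lia.
- move=> _ _ _ _ /rel_ord[a [c [-> -> _ Wac]]] /rel_ord[b [d [-> -> _ Wbd]]] ab bc cd.
  move/'forall_'forall_'forall_'forall_implyP: nc_W => /(_ a b c d).
  by rewrite ab bc cd Wac Wbd => /(_ isT).
Qed.

Lemma arcs_of_relK N (W : arcs N) : is_web W -> arcs_of_rel N (rel_of_arcs W) = W.
Proof.
move=> webW; apply/setP => A; apply/arcs_of_relP/idP.
  by move=> [a [b []]]; rewrite rel_of_arcsE => /andP[_ Wab] ->.
case/andP: webW => /andP[_ /forall_inP card_W] _ WA.
have [a [b [ab eq_A]]] := set2_lt (eqP (card_W A WA)).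
by exists a, b; rewrite rel_of_arcsE ab -eq_A.
Qed.

Definition left_of (R : rel nat) v := exists b, R v b.

(* If the two partners of [a] differed, the vertex [b] would have a partner [c]
   for the second relation with the same defect and [a < c]. *)
Lemma arc_relation_lt_absurd N (R1 R2 : rel nat) a b b' :
  arc_relation N R1 -> arc_relation N R2 ->
  (forall v, left_of R1 v <-> left_of R2 v) ->
  R1 a b -> R2 a b' -> b < b' -> False.
Proof.
move=> [R1_dom R1_ex R1_uniq R1_nc] [R2_dom R2_ex R2_uniq R2_nc] eq_left.
have [k] := ubnP (N - a); elim: k a b b' => // k IHk a b b' le_k R1ab R2ab' lt_b.
have dom1 := R1_dom _ _ R1ab; have dom2 := R2_dom _ _ R2ab'.
have [|/eq_left[c R1bc]|[c R2cb]] := R2_ex b; first by lia.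
  have := R1_uniq _ _ _ _ R1ab R1bc; rewrite eqxx !orbT => /(_ isT); lia.
have dom3 := R2_dom _ _ R2cb.
have [lt_ca|lt_ac|eq_ca] := ltngtP c a.
- by apply: (R2_nc _ _ _ _ R2cb R2ab'); lia.
- have [d R1cd] : left_of R1 c by apply/eq_left; exists b.
  have [lt_db|lt_bd|eq_db] := ltngtP d b.
  + by apply: (IHk c d b) => //; lia.
  + by apply: (R1_nc _ _ _ _ R1ab R1cd); lia.
  + have := R1_uniq _ _ _ _ R1ab R1cd; rewrite eq_db eqxx !orbT => /(_ isT); lia.
- have := R2_uniq _ _ _ _ R2cb R2ab'; rewrite eq_ca eqxx => /(_ isT); lia.
Qed.

Lemma arc_relation_unique N (R1 R2 : rel nat) :
  arc_relation N R1 -> arc_relation N R2 ->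
  (forall v, left_of R1 v <-> left_of R2 v) -> R1 =2 R2.
Proof.
move=> R1P R2P eq_left.
have sub (S1 S2 : rel nat) : arc_relation N S1 -> arc_relation N S2 ->
    (forall v, left_of S1 v <-> left_of S2 v) -> forall a b, S1 a b -> S2 a b.
  move=> S1P S2P eqS a b S1ab; have [b' S2ab'] : left_of S2 a by apply/eqS; exists b.
  have eqS' v : left_of S2 v <-> left_of S1 v by split=> /eqS.
  have [lt_b|lt_b|->] // := ltngtP b b'.
    by case: (arc_relation_lt_absurd S1P S2P eqS S1ab S2ab' lt_b).
  by case: (arc_relation_lt_absurd S2P S1P eqS' S2ab' S1ab lt_b).
by move=> a b; apply/idP/idP; apply: sub => // v; split=> /eq_left.
Qed.

(** The web of [R] shows that [pick] succeeds, and any web picked has the same left endpoints as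
    [R], hence the same arcs. *)
Lemma web_ofE n T (R : rel nat) : arc_relation (2 * n) R ->
  (forall v, v <= 2 * n -> (v \in nth [::] T 0) <-> exists b, R v b) ->
  (forall v, v <= 2 * n -> (v \in nth [::] T 1) <-> exists a, R a v) ->
  web_of n T = arcs_of_rel (2 * n) R.
Proof.
move=> RP row0 row1; set N := 2 * n in RP row0 row1 *.
have [R_dom _ _ _] := RP.
have left_iff (W : arcs N) v : is_web W ->
    left_endpoints W == [set v : 'I_N.+1 | val v \in nth [::] T 0] ->
    left_of (rel_of_arcs W) v <-> left_of R v.
  move=> webW /eqP/setP left_W; have [W_dom _ _ _] := rel_of_arcs_rel webW.
  have key (i : 'I_N.+1) : left_of (rel_of_arcs W) i <-> left_of R i.
    rewrite /left_of -row0 ?leq_ord //; have := left_W i; rewrite !inE => <-.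
    split=> [[b Wib]|/existsP[b]]; last by rewrite -rel_of_arcsE; exists b.
    have lt_b : b < N.+1 by have := W_dom _ _ Wib; lia.
    by apply/existsP; exists (Ordinal lt_b); rewrite -rel_of_arcsE.
  have [lt_v|lt_v] := ltnP v N.+1; first exact: key (Ordinal lt_v).
  by split=> [[b /W_dom]|[b /R_dom]]; lia.
rewrite /web_of; case: pickP => [W /and3P[webW left_W _]|/(_ (arcs_of_rel N R))] /=.
  rewrite -[LHS](arcs_of_relK webW); apply/setP => A; rewrite !inE.
  have eqR := arc_relation_unique (rel_of_arcs_rel webW) RP
    (fun v => left_iff W v webW left_W).
  by apply: eq_existsb => a; apply: eq_existsb => b; rewrite eqR.
case/negP; apply/and3P; split; first exact: is_web_arcs_of_rel.
- apply/eqP/setP => v; rewrite !inE; apply/existsP/idP.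
    move=> [b /andP[ab]]; rewrite (mem_arcs_of_rel RP (ltnW ab)) => Rvb.
    by apply/(row0 v (leq_ord v)); exists b.
  move/(row0 v (leq_ord v)) => [b Rvb]; have dom_vb := R_dom _ _ Rvb.
  have lt_b : b < N.+1 by lia.
  have le_vb : v <= Ordinal lt_b by rewrite /=; lia.
  by exists (Ordinal lt_b); rewrite (mem_arcs_of_rel RP le_vb) /= Rvb; lia.
- apply/eqP/setP => v; rewrite !inE; apply/existsP/idP.
    move=> [a /andP[av]]; rewrite (mem_arcs_of_rel RP (ltnW av)) => Rav.
    by apply/(row1 v (leq_ord v)); exists a.
  move/(row1 v (leq_ord v)) => [a Rav]; have dom_av := R_dom _ _ Rav.
  have lt_a : a < N.+1 by lia.
  have le_av : Ordinal lt_a <= v by rewrite /=; lia.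
  by exists (Ordinal lt_a); rewrite (mem_arcs_of_rel RP le_av) /= Rav; lia.
Qed.

(** * Matching the steps of a ballot word, and folding the matching *)

Definition ups (w : seq bool) k := count id (take k w).

(* The lattice path of [w] has height [2 * ups w k - k] after [k] steps; the
   comparisons of heights are written without subtraction. *)
Definition arc_of_word (w : seq bool) : rel nat := fun a b =>
  [&& 0 < a, a < b, b <= size w, 2 * ups w a.-1 + b == 2 * ups w b + a.-1
    & all (fun k => 2 * ups w b + k < 2 * ups w k + b) (iota a (b - a))].

Lemma arc_of_wordP w a b :
  reflect [/\ 0 < a, a < b, b <= size w, 2 * ups w a.-1 + b = 2 * ups w b + a.-1
            & forall k, a <= k < b -> 2 * ups w b + k < 2 * ups w k + b]
          (arc_of_word w a b).
Proof.
apply: (iffP and5P) => -[a_gt0 lt_ab le_b eq_h gt_h]; split=> //.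
- exact/eqP.
- by move=> k in_ab; apply: (allP gt_h); rewrite mem_iota subnKC // ltnW.
- exact/eqP.
- by apply/allP => k; rewrite mem_iota subnKC ?(ltnW lt_ab) //; apply: gt_h.
Qed.

Lemma upsS w k : k < size w -> ups w k.+1 = ups w k + nth true w k.
Proof.
by move=> lt_k; rewrite /ups (take_nth true) // -cats1 count_cat /= addn0.
Qed.

Lemma arc_of_word_steps w a b : arc_of_word w a b ->
  nth true w a.-1 /\ nth true w b.-1 = false.
Proof.
move=> /arc_of_wordP[a_gt0 lt_ab le_b eq_h gt_h].
have := gt_h a; have := gt_h b.-1; have := @upsS w a.-1; have := @upsS w b.-1.
rewrite !prednK ?(ltn_trans a_gt0 lt_ab) //.
by case: (nth true w a.-1); case: (nth true w b.-1) => /=; split; lia.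
Qed.

Definition ballot w := [/\ forall k, k <= size w -> k <= 2 * ups w k
  & 2 * ups w (size w) = size w].

Lemma arc_of_word_rel w : ballot w -> arc_relation (size w) (arc_of_word w).
Proof.
move=> [ge_h h_end]; split.
- by move=> a b /arc_of_wordP[-> -> ->].
- move=> v /andP[v_gt0 le_v].
  have := @upsS w v.-1; rewrite prednK // => /(_ le_v).
  case: (nth true w v.-1) => step; [left|right].
  (* The partner of an up-step is the first return to the height before it; a return exists since
     the path ends on the axis. *)
  + pose P j := (v <= j) && (2 * ups w j + v.-1 <= 2 * ups w v.-1 + j).
    have exP : exists j, P j by exists (size w); rewrite /P; have := ge_h v.-1; lia.
    case: (ex_minnP exP) => j /andP[le_vj le_hj] min_j.
    have neq_jv : v != j by apply/eqP => eq_jv; rewrite -eq_jv in le_hj; lia.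
    have le_j : j <= size w by apply: min_j; rewrite /P; have := ge_h v.-1; lia.
    have gt_h k : v <= k < j -> 2 * ups w v.-1 + k < 2 * ups w k + v.-1.
      move=> in_vj; rewrite ltnNge; apply/negP => le_hk.
      by have := min_j k; rewrite /P; lia.
    have := gt_h j.-1; have := @upsS w j.-1; rewrite prednK; last by lia.
    move=> stepj gt_hj; exists j; apply/arc_of_wordP; split=> //; try lia.
    by move=> k /gt_h; lia.
  (* The partner of a down-step [v] is the step after the last earlier point that is no higher than
     the point after [v]; the origin is such a point. *)
  + pose P i := (i < v) && (2 * ups w i + v <= 2 * ups w v + i).
    have exP : exists i, P i.
      by exists 0; rewrite /P /ups take0 /= -/(ups w v); have := ge_h v; lia.
    have leP i : P i -> i <= v by case/andP => /ltnW.
    case: (ex_maxnP exP leP) => i /andP[lt_iv le_hi] max_i.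
    have neq_iv : i != v.-1 by apply/eqP => eq_iv; rewrite eq_iv in le_hi; lia.
    have gt_h k : i < k < v -> 2 * ups w v + k < 2 * ups w k + v.
      move=> in_iv; rewrite ltnNge; apply/negP => le_hk.
      by have := max_i k; rewrite /P; lia.
    have := gt_h i.+1; have := @upsS w i.
    move=> stepi gt_hi; exists i.+1; apply/arc_of_wordP; split=> //=; lia.
- move=> a b c d /arc_of_wordP[a0 ab bN eq_ab gt_ab].
  move=> /arc_of_wordP[c0 cd dN eq_cd gt_cd] meet.
  have := gt_ab d; have := gt_ab c.-1; have := gt_ab c.
  have := gt_cd b; have := gt_cd a.-1; have := gt_cd a.
  by case/or4P: meet => /eqP eq; subst; lia.
- move=> a b c d /arc_of_wordP[_ ac _ eq_ac gt_ac] /arc_of_wordP[_ bd _ eq_bd gt_bd].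
  (* With [h] the height, a crossing gives [h(b - 1) > h(c) > h(d) = h(b - 1)]. *)
  by move=> ab bc cd; have := gt_ac b.-1; have := gt_bd c; lia.
Qed.

(** * Symmetric matchings and their folding *)

Definition symmetric_rel N (R : rel nat) :=
  forall a b, R a b -> R (N + 1 - b) (N + 1 - a).

(** Otherwise the arc and its mirror image would cross each other at the axis. *)
Lemma symmetric_rel_crossing N (R : rel nat) a b n : arc_relation N R ->
  symmetric_rel N R -> N = 2 * n -> R a b -> a <= n -> n < b -> b = N + 1 - a.
Proof.
move=> [R_dom _ _ R_nc] symR eqN Rab le_an lt_nb; have dom := R_dom _ _ Rab.
have := R_nc _ _ _ _ Rab (symR _ _ Rab); have := R_nc _ _ _ _ (symR _ _ Rab) Rab.
by have [||] := ltngtP (N + 1 - b) a; lia.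
Qed.

(** The vertex [j <= n] and its reflection occupy the places [2n + 1 - 2j] and [2n + 2 - 2j]. Larger
    [j] gives smaller places, so the end coming from [b] is the left one in the first two cases. *)
Definition fold_cases n a b x y :=
  [\/ [/\ b <= n, x = 2 * n + 2 - 2 * b & y = 2 * n + 1 - 2 * a],
      [/\ b <= n, x = 2 * n + 1 - 2 * b & y = 2 * n + 2 - 2 * a]
    | [/\ b = 2 * n + 1 - a, a <= n, x = 2 * n + 1 - 2 * a & y = 2 * n + 2 - 2 * a]].

Definition fold_rel n (R : rel nat) : rel nat := fun x y =>
  [exists a : 'I_(2 * n).+1, exists b : 'I_(2 * n).+1, R a b &&
    [|| [&& b <= n, x == 2 * n + 2 - 2 * b & y == 2 * n + 1 - 2 * a],
        [&& b <= n, x == 2 * n + 1 - 2 * b & y == 2 * n + 2 - 2 * a]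
      | [&& b == 2 * n + 1 - a :> nat, a <= n, x == 2 * n + 1 - 2 * a
          & y == 2 * n + 2 - 2 * a]]].

Lemma fold_relP n R x y : arc_relation (2 * n) R ->
  reflect (exists a b, R a b /\ fold_cases n a b x y) (fold_rel n R x y).
Proof.
move=> [R_dom _ _ _]; apply: (iffP existsP).
  move=> [a /existsP[b /andP[Rab cases]]]; exists a, b; split=> //.
  by case/or3P: cases => [/and3P[]|/and3P[]|/and4P[]] => *;
    [apply: Or31 | apply: Or32 | apply: Or33]; split=> //; apply/eqP.
move=> [a [b [Rab cases]]]; have dom := R_dom _ _ Rab.
have lt_a : a < (2 * n).+1 by lia.
have lt_b : b < (2 * n).+1 by lia.
exists (Ordinal lt_a); apply/existsP; exists (Ordinal lt_b); rewrite /= Rab /=.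
by case: cases => -[] *; apply/or3P; [apply: Or31 | apply: Or32 | apply: Or33]; lia.
Qed.

Lemma fold_rel_arc_relation n R : arc_relation (2 * n) R ->
  symmetric_rel (2 * n) R -> arc_relation (2 * n) (fold_rel n R).
Proof.
move=> RP symR; have [R_dom R_ex R_uniq R_nc] := RP; split.
- move=> x y /(fold_relP _ _ RP)[a [b [/R_dom dom]]].
  by case=> -[*]; lia.
- move=> v dom_v.
  have [j [dom_j eq_v]] : exists j, 0 < j <= n /\
      (v = 2 * n + 2 - 2 * j \/ v = 2 * n + 1 - 2 * j).
    exists (2 * n + 2 - v)./2; lia.
  have [[b Rjb]|[a Raj]] := R_ex j ltac:(lia).
  + have [le_bn|lt_nb] := leqP b n.
      right; case: eq_v => eq_v.
        exists (2 * n + 1 - 2 * b); apply/fold_relP => //; exists j, b; split=> //.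
        by apply: Or32.
      exists (2 * n + 2 - 2 * b); apply/fold_relP => //; exists j, b; split=> //.
      by apply: Or31.
    have eq_b := symmetric_rel_crossing RP symR erefl Rjb ltac:(lia) lt_nb.
    case: eq_v => eq_v.
      right; exists (2 * n + 1 - 2 * j); apply/fold_relP => //.
      by exists j, b; split=> //; apply: Or33; split=> //; lia.
    left; exists (2 * n + 2 - 2 * j); apply/fold_relP => //.
    by exists j, b; split=> //; apply: Or33; split=> //; lia.
  + left; case: eq_v => eq_v.
      exists (2 * n + 1 - 2 * a); apply/fold_relP => //; exists a, j; split=> //.
      by apply: Or31; split=> //; lia.
    exists (2 * n + 2 - 2 * a); apply/fold_relP => //; exists a, j; split=> //.
    by apply: Or32; split=> //; lia.
- move=> x y x' y' /(fold_relP _ _ RP)[a [b [Rab cab]]].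
  move=> /(fold_relP _ _ RP)[c [d [Rcd ccd]]].
  have := R_uniq _ _ _ _ Rab Rcd; have := R_dom _ _ Rab; have := R_dom _ _ Rcd.
  move=> dom1 dom2 uniq meet.
  by case: cab => -[*]; case: ccd => -[*]; lia.
(* The two copies of one arc are nested, an arc across the axis becomes one between neighbours, and
   copies of distinct arcs cross only if these arcs do. *)
- move=> x y z t /(fold_relP _ _ RP)[a [b [Rab cab]]].
  move=> /(fold_relP _ _ RP)[c [d [Rcd ccd]]] xy yz zt.
  have := R_uniq _ _ _ _ Rab Rcd; have := R_dom _ _ Rab; have := R_dom _ _ Rcd.
  have := R_nc _ _ _ _ Rab Rcd; have := R_nc _ _ _ _ Rcd Rab.
  move=> nc1 nc2 dom1 dom2 uniq.
  by case: cab => -[*]; case: ccd => -[*]; lia.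
Qed.

Lemma mem_arc N R a b : arc_relation N R -> a <= b -> b <= N ->
  (Defs.arc N a b \in arcs_of_rel N R) = R a b.
Proof.
move=> RP le_ab le_bN; have le_aN := leq_trans le_ab le_bN.
by rewrite (mem_arcs_of_rel RP) !inordK.
Qed.

Lemma arcC N x y : Defs.arc N x y = Defs.arc N y x.
Proof. by rewrite /Defs.arc setUC. Qed.

Lemma notin_arc0 N R y : arc_relation N R ->
  Defs.arc N 0 y \notin arcs_of_rel N R.
Proof.
move=> [R_dom _ _ _]; apply/negP => /arcs_of_relP[c [d [/R_dom dom]]].
have val0 : nat_of_ord (inord 0 : 'I_N.+1) = 0 by rewrite inordK.
by case/set2_inj => -[eq1 eq2]; move: dom; rewrite -eq1 val0; lia.
Qed.

(** [fold_web] asks for an arc together with its mirror image, [fold_rel] for the arc alone;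
    symmetry supplies the image. *)
Lemma fold_web_arcs_of_rel n R : arc_relation (2 * n) R ->
  symmetric_rel (2 * n) R ->
  fold_web (arcs_of_rel (2 * n) R : arcs (2 * n)) = arcs_of_rel (2 * n) (fold_rel n R).
Proof.
move=> RP symR; have [R_dom _ _ _] := RP.
have FP := fold_rel_arc_relation RP symR; have [F_dom _ _ _] := FP.
have memF x y : fold_rel n R x y ->
    Defs.arc (2 * n) x y \in arcs_of_rel (2 * n) (fold_rel n R).
  by move=> Fxy; have := F_dom _ _ Fxy => dom; rewrite mem_arc //; lia.
apply/setP => A; rewrite [LHS]inE; apply/idP/idP.
  case/orP => [/existsP[a /existsP[b /and5P[ab bn]]]|/existsP[a /and3P[an]]].
    rewrite mem_arc ?leq_ord ?(ltnW ab) // => Rab _ eqA.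
    case/orP: eqA => /eqP->; rewrite arcC; apply: memF; apply/fold_relP => //;
      exists a, b; split=> //; [exact: Or31 | exact: Or32].
  (* The quantifier in [fold_web] also ranges over 0, which is no vertex and whose reflection is out
     of range. *)
  have [eq_a|a_gt0] := posnP a; first by rewrite eq_a (negbTE (notin_arc0 _ RP)).
  rewrite mem_arc //; try lia.
  move=> Rab /eqP->; apply: memF; apply/fold_relP => //.
  exists a, (2 * n + 1 - a); split=> //; exact: Or33.
case/arcs_of_relP => x [y [Fxy ->]].
have -> : [set x; y] = Defs.arc (2 * n) x y by rewrite /Defs.arc !inord_val.
have /(fold_relP _ _ RP)[a [b [Rab cases]]] := Fxy.
have dom := R_dom _ _ Rab.
have lt_a : a < (2 * n).+1 by lia.
have lt_b : b < (2 * n).+1 by lia.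
have Rsym := symR _ _ Rab.
case: cases => -[]; [move=> bn -> ->|move=> bn -> ->|move=> eq_b an -> ->];
  apply/orP; [left|left|right]; apply/existsP; exists (Ordinal lt_a).
- apply/existsP; exists (Ordinal lt_b) => /=.
  rewrite (arcC _ (2 * n + 1 - a)) !mem_arc ?Rab ?Rsym ?bn //; try lia.
  by rewrite (arcC _ (2 * n + 2 - 2 * b)) eqxx; lia.
- apply/existsP; exists (Ordinal lt_b) => /=.
  rewrite (arcC _ (2 * n + 1 - a)) !mem_arc ?Rab ?Rsym ?bn //; try lia.
  by rewrite (arcC _ (2 * n + 1 - 2 * b)) eqxx orbT; lia.
- by rewrite /= -eq_b mem_arc ?Rab ?an ?eqxx //; lia.
Qed.

(** The last [k] letters contain as many up-steps as the first [k] contain down-steps. *)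
Lemma ups_symmetric w k : rev (map negb w) = w -> k <= size w ->
  ups w (size w - k) + k = ups w k + ups w (size w).
Proof.
move=> sym_w le_k.
have -> : ups w (size w) = ups w (size w - k) + count id (drop (size w - k) w).
  by rewrite /ups take_size -count_cat cat_take_drop.
have -> : count id (drop (size w - k) w) = count (predC id) (take k w).
  rewrite -{2}sym_w drop_rev size_map subKn // count_rev -map_take count_map.
  exact: eq_count.
have := count_predC id (take k w); rewrite size_takel // -/(ups w k) => eq_k.
by rewrite addnCA eq_k.
Qed.

Lemma arc_of_word_symmetric w : rev (map negb w) = w -> ballot w ->
  symmetric_rel (size w) (arc_of_word w).
Proof.
move=> sym_w [_ h_end] a b /arc_of_wordP[a0 ab bN eq_h gt_h].
(* The path has the same height after [k] and after [size w - k] steps. *)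
have upsN k : k <= size w -> 2 * ups w (size w - k) + 2 * k = 2 * ups w k + size w.
  by move=> le_k; have := ups_symmetric sym_w le_k; lia.
have := upsN b bN; have := upsN a.-1.
rewrite (_ : size w - a.-1 = size w + 1 - a); last by lia.
rewrite (_ : size w - b = (size w + 1 - b).-1); last by lia.
move=> upsa upsb; apply/arc_of_wordP; split; try lia.
move=> k in_ab; have := upsN k; have := gt_h (size w - k); lia.
Qed.

(** * The letters of the folded word at the ends of folded arcs *)

Lemma size_slice w i j : j <= size w -> size (slice w i j) = j - i.
Proof. by move=> le_j; rewrite size_drop size_takel. Qed.

Lemma count_slice w i j : i <= j -> count id (slice w i j) + ups w i = ups w j.
Proof.
move=> le_ij; rewrite addnC /ups -(take_takel w le_ij) -count_cat.
by rewrite cat_take_drop.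
Qed.

Lemma take_slice w i j k : i + k <= j -> take k (slice w i j) = slice w i (i + k).
Proof. by move=> le_k; rewrite take_drop take_takel // addnC. Qed.

Lemma slice_cat w i j k : i <= j -> j <= k -> slice w i k = slice w i j ++ slice w j k.
Proof.
move=> le_ij le_jk; rewrite -[LHS](cat_take_drop (j - i)) take_slice subnKC //.
by rewrite /slice drop_drop subnK.
Qed.

Lemma slice_rcons w i j : i <= j -> j < size w ->
  slice w i j.+1 = rcons (slice w i j) (nth true w j).
Proof.
move=> le_ij lt_j; rewrite /slice (take_nth true) // drop_rcons //.
by rewrite size_takel // ltnW.
Qed.

Lemma run_slice w h i j : i <= j -> j <= size w ->
  (forall k, i <= k <= j -> 2 * ups w i + k <= 2 * ups w k + i + h) ->
  run h (slice w i j) = Some (2 * ups w j + i + h - (2 * ups w i + j)).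
Proof.
move=> le_ij le_j ge_h.
have countN s : count negb s = size s - count id s.
  by rewrite -(count_predC id s) addKn.
rewrite run_count.
  have := count_slice w le_ij; rewrite countN size_slice // => eq_c.
  have le_c := count_size id (slice w i j); rewrite size_slice // in le_c.
  by have ge_hj := ge_h j; congr Some; lia.
move=> k; rewrite size_slice // => le_k.
have le_ik : i <= i + k by lia.
rewrite take_slice; last by lia.
have := count_slice w le_ik; rewrite countN size_slice; last by lia.
by have := ge_h (i + k); lia.
Qed.

Lemma falls_slice w a b j : arc_of_word w a b -> b <= j -> j <= size w ->
  falls 0 (slice w a j).
Proof.
move=> Rab le_bj le_j; case/arc_of_wordP: (Rab) => a0 ab bN eq_h gt_h.
have [up_a _] := arc_of_word_steps Rab.
have := @upsS w a.-1; rewrite prednK // up_a => upa.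
rewrite (slice_cat _ (ltnW ab) le_bj); apply: falls_cat.
(* Started at height 1, the path after step [a] reaches 0 at [b]; started at 0 it must fall. *)
apply: (@run_falls 1 _ 0 0) => //; rewrite run_slice ?(ltnW ab) //.
  by congr Some; lia.
move=> k in_k; have [eq_k|neq_k] := eqVneq k b; last by have := gt_h k; lia.
by rewrite eq_k; lia.
Qed.

Lemma last_rectify_slice_up w h i j : i <= j -> j < size w -> nth true w j ->
  last true (rectify h (slice w i j.+1)) = true.
Proof.
move=> le_ij lt_j up_j; rewrite slice_rcons // up_j -cats1.
by have [h' ->] := rectify_cat h (slice w i j); rewrite last_cat.
Qed.

(** The factor begins just after [a], and the steps strictly between [a] and [b] are matched among
    themselves, so [b] has lost its partner and is raised. *)
Lemma last_rectify_slice_free w a b : arc_of_word w a b ->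
  last true (rectify 0 (slice w a b)) = true.
Proof.
move=> Rab; case/arc_of_wordP: (Rab) => a0 ab bN eq_h gt_h.
have [up_a down_b] := arc_of_word_steps Rab.
have := @upsS w a.-1; rewrite prednK // up_a => upa.
have := @upsS w b.-1; rewrite prednK ?down_b => [upb|]; last by lia.
have lt_ab : a <= b.-1 by lia.
have run_ab : run 0 (slice w a b.-1) = Some 0.
  rewrite run_slice //; [by congr Some; lia | by lia|].
  by move=> k in_k; have := gt_h k; lia.
have -> : b = b.-1.+1 by lia.
rewrite slice_rcons //; last by lia.
by rewrite down_b -cats1 (run_rectify_cat _ run_ab) last_cat.
Qed.

Lemma last_rectify_slice_down w i a b : arc_of_word w a b -> i < a ->
  last true (rectify 0 (slice w i b)) = false.
Proof.
move=> Rab lt_ia; case/arc_of_wordP: (Rab) => a0 ab bN eq_h gt_h.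
have [_ down_b] := arc_of_word_steps Rab.
have le_ia : i <= a.-1 by lia.
have le_ab : a.-1 <= b by lia.
(* The part from [a] to [b] never goes below its starting height, so rectification leaves it alone
   whatever precedes it. *)
rewrite (slice_cat _ le_ia le_ab).
have [h' ->] := rectify_cat 0 (slice w i a.-1).
rewrite (run_rectify (run_slice le_ab bN _)).
  have eq_b : b = b.-1.+1 by lia.
  rewrite [in slice _ _ b]eq_b slice_rcons ?last_cat ?last_rcons //; lia.
move=> k in_k; have [->|neq_k] := eqVneq k a.-1; first by lia.
have [->|neq_k'] := eqVneq k b; first by lia.
by have := gt_h k; lia.
Qed.

(** Step [j] of folding fills the places [2n + 1 - 2j] and [2n + 2 - 2j]. The first is down exactly
    when the reflection of [j] is a down-step with partner beyond [j]; the second exactly when [j]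
    is an up-step with partner at most its reflection. The three cases of [fold_cases] are checked
    against this. *)
Lemma fold_letters_fold_rel n w x y : size w = 2 * n -> ballot w ->
  rev (map negb w) = w -> fold_rel n (arc_of_word w) x y ->
  nth true (fold_letters n w) x.-1 /\ nth true (fold_letters n w) y.-1 = false.
Proof.
move=> sz_w ball_w sym_w.
have RP := arc_of_word_rel ball_w; have symR := arc_of_word_symmetric sym_w ball_w.
have sz_w2 : size w = n.*2 by rewrite sz_w mul2n.
have eq_slice a : 0 < a <= n ->
    slice w a.-1.+1 (n.*2 - a.-1) = slice w a (2 * n + 1 - a).
  by move=> dom_a; congr slice; lia.
have letter_odd a : 0 < a <= n -> nth true (fold_letters n w) (2 * n + 1 - 2 * a).-1
    = last true (rectify 0 (slice w a (2 * n + 1 - a))).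
  move=> dom_a; have lt_a : a.-1 < n by lia.
  rewrite -eq_slice // -(nth_fold_letters sz_w2 lt_a); congr nth; lia.
have letter_even a : 0 < a <= n -> nth true (fold_letters n w) (2 * n + 2 - 2 * a).-1
    = ~~ (nth true w a.-1 && falls 0 (slice w a (2 * n + 1 - a))).
  move=> dom_a; have lt_a : a.-1 < n by lia.
  rewrite -eq_slice // -(nth_fold_letters sz_w2 lt_a); congr nth; lia.
rewrite sz_w in RP symR; have [R_dom _ _ _] := RP.
case/(fold_relP _ _ RP) => a [b [Rab]]; have dom := R_dom _ _ Rab.
have [up_a down_b] := arc_of_word_steps Rab.
case=> -[].
- move=> le_bn -> ->; rewrite letter_odd ?letter_even; try lia.
  rewrite down_b; split=> //.
  by apply: last_rectify_slice_down (symR _ _ Rab) _; lia.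
- move=> le_bn -> ->; rewrite letter_odd ?letter_even; try lia.
  rewrite up_a (falls_slice Rab) /=; try lia.
  (* The mirror arc starts at the reflection of [b], an up-step, which rectification keeps. *)
  split=> //; have [up_b' _] := arc_of_word_steps (symR _ _ Rab).
  have -> : 2 * n + 1 - b = (2 * n + 1 - b).-1.+1 by lia.
  by rewrite last_rectify_slice_up //; lia.
- move=> eq_b le_an -> ->; rewrite letter_odd ?letter_even; try lia.
  by rewrite up_a -eq_b last_rectify_slice_free // (falls_slice Rab) //; lia.
Qed.

(** Since [R] covers all vertices, the letters at the ends of its arcs determine both rows. *)
Lemma web_of_tab n w R : size w = 2 * n -> arc_relation (2 * n) R ->
  (forall a b, R a b -> nth true w a.-1 /\ nth true w b.-1 = false) ->
  web_of n (tab w) = arcs_of_rel (2 * n) R.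
Proof.
move=> sz_w RP steps; have [R_dom R_ex _ _] := RP.
have memE c v : (v \in positions c 1 w)
    = (0 < v <= 2 * n) && (nth (~~ c) w v.-1 == c).
  by rewrite mem_positions sz_w subn1 add1n ltnS andbA.
have nthE c v : 0 < v <= 2 * n -> nth (~~ c) w v.-1 = nth true w v.-1.
  by move=> dom_v; apply: set_nth_default; lia.
apply: web_ofE => // v _; rewrite /= memE; split.
- case/andP=> dom_v; rewrite nthE // => /eqP up_v.
  have [//|[a Rav]] := R_ex v dom_v.
  by have [_] := steps _ _ Rav; rewrite up_v.
- case=> b Rvb; have dom := R_dom _ _ Rvb; have [up_v _] := steps _ _ Rvb.
  by have dom_v : 0 < v <= 2 * n by [lia]; rewrite dom_v nthE // up_v.
- case/andP=> dom_v; rewrite nthE // => /eqP down_v.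
  have [[b Rvb]|//] := R_ex v dom_v.
  by have [] := steps _ _ Rvb; rewrite down_v.
- case=> a Rav; have dom := R_dom _ _ Rav; have [_ down_v] := steps _ _ Rav.
  by have dom_v : 0 < v <= 2 * n by [lia]; rewrite dom_v nthE // down_v.
Qed.

Theorem theorem1p1 (n : nat) (T : tableau) :
  0 < n ->
  is_SYT [:: n; n] T ->
  rotationally_symmetric T ->
  web_of n (folding T) = fold_web (web_of n T).
Proof.
move=> _ /SYT_tab[w [-> sz_w count_w ge_h]] evac_w.
have h_end : 2 * ups w (size w) = size w by rewrite /ups take_size count_w sz_w.
have ball_w : ballot w by [].
have ups0 : ups w 0 = 0 by rewrite /ups take0.
have run_w : run 0 w = Some 0.
  have := @run_slice w 0 0 (size w) (leq0n _) (leqnn _).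
  rewrite /slice take_size drop0 => ->.
    by congr Some; lia.
  by move=> k le_k; have := ge_h k le_k; rewrite -/(ups w k); lia.
(* This is self-evacuation, read through [evacuation_tab]. *)
have sym_w : rev (map negb w) = w.
  apply: tab_inj; first by rewrite size_rev size_map.
  by rewrite -evacuation_tab.
have RP := arc_of_word_rel ball_w; have symR := arc_of_word_symmetric sym_w ball_w.
rewrite sz_w in RP symR.
rewrite (web_of_tab sz_w RP (@arc_of_word_steps w)) fold_web_arcs_of_rel //.
have even_w : ~~ odd (size w) by lia.
have half_w : (size w)./2 = n by lia.
rewrite folding_tab // half_w.
apply: web_of_tab; first by rewrite size_fold_letters mul2n.
  exact: fold_rel_arc_relation.
by move=> a b; apply: fold_letters_fold_rel.
Qed.
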